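(* Let $f\in C^m(\mathbb{R}^3)$ be an axially symmetric scalar function (i.e. $f=f(r,z)$ in cylindrical coordinates). Let $\mathfrak{M}=(m_c,m_r,m_z)$ be a multi-index of nonnegative integers with $|\mathfrak{M}|=2m_c+m_r+m_z=m$. Then $$ (\nabla^m f)_{2m_c\theta,\,m_r r,\,m_z z}=(2m_c-1)!!\,r^{2m_c}\,\partial_z^{m_z}\partial_r^{m_r}\Big(\frac{\partial_r}{r}\Big)^{m_c}f . $$ Consequently, $$ (\nabla^m f):\underbrace{\boldsymbol{e_\theta}\otimes\cdots\otimes\boldsymbol{e_\theta}}_{2m_c\text{ times}}\otimes\underbrace{\boldsymbol{e_r}\otimes\cdots\otimes\boldsymbol{e_r}}_{m_r\text{ times}}\otimes\underbrace{\boldsymbol{e_z}\otimes\cdots\otimes\boldsymbol{e_z}}_{m_z\text{ times}}=(2m_c-1)!!\,\mathcal{D}^{\mathfrak{M}}f, $$ and $$ |\nabla^m f|^2\simeq\sum_{|\mathfrak{M}|=m}\big|\mathcal{D}^{\mathfrak{M}}f\big|^2 . $$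
   Context: Cylindrical coordinates $(r,\theta,z)$ on $\mathbb{R}^3$: $x=(r\cos\theta,r\sin\theta,z)$, with orthonormal frame $\boldsymbol{e_r}=(\cos\theta,\sin\theta,0)$, $\boldsymbol{e_\theta}=(-\sin\theta,\cos\theta,0)$, $\boldsymbol{e_z}=(0,0,1)$ and coordinate (covariant) frame $\mathfrak{E}_r=\boldsymbol{e_r}$, $\mathfrak{E}_\theta=r\boldsymbol{e_\theta}$, $\mathfrak{E}_z=\boldsymbol{e_z}$; identities are understood where $r>0$. $\nabla^m f$ is the $m$-th (Euclidean, covariant) derivative tensor of $f$, a symmetric $m$-tensor, and $\nabla^m f:\boldsymbol{a}_1\otimes\cdots\otimes\boldsymbol{a}_m$ denotes its full contraction with (evaluation on) the vectors $\boldsymbol{a}_1,\dots,\boldsymbol{a}_m$. Define $$(\nabla^m f)_{2m_c\theta,\,m_r r,\,m_z z}:=\nabla^m f:\underbrace{\mathfrak{E}_\theta\otimes\cdots\otimes\mathfrak{E}_\theta}_{2m_c}\otimes\underbrace{\mathfrak{E}_r\otimes\cdots\otimes\mathfrak{E}_r}_{m_r}\otimes\underbrace{\mathfrak{E}_z\otimes\cdots\otimes\mathfrak{E}_z}_{m_z}.$$ The operator $\frac{\partial_r}{r}$ is $g\mapsto\frac1r\partial_r g$, and $\mathcal{D}^{\mathfrak{M}}:=\partial_z^{m_z}\partial_r^{m_r}\big(\frac{\partial_r}{r}\big)^{m_c}$ for $\mathfrak{M}=(m_c,m_r,m_z)$, $|\mathfrak{M}|:=2m_c+m_r+m_z$.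 Convention: $(-1)!!=1$. $A\simeq B$ means $A\le CB$ and $B\le CA$ for a constant $C>0$ (here depending only on $m$). *)

(* Defs.v *)
From mathcomp Require Import all_boot all_order all_algebra.
From mathcomp Require Import all_classical all_reals all_analysis.
Import Order.TTheory GRing.Theory Num.Theory numFieldNormedType.Exports.

Set Implicit Arguments.
Unset Strict Implicit.
Unset Printing Implicit Defensive.

Local Open Scope classical_set_scope.
Local Open Scope ring_scope.

Definition vec3 (R : realType) (a b c : R) : 'rV[R]_3 :=
  \row_(i < 3) [:: a; b; c]`_i.

Definition pderiv (R : realType) (i : 'I_3) (f : 'rV[R]_3 -> R) :
    'rV[R]_3 -> R :=
  fun x => 'D_(delta_mx 0 i) f x.

Definition pderivs (R : realType) (s : seq 'I_3) (f : 'rV[R]_3 -> R) :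
    'rV[R]_3 -> R :=
  foldr (@pderiv R) f s.

Definition Ck (R : realType) (m : nat) (f : 'rV[R]_3 -> R) : Prop :=
  (forall (s : seq 'I_3) (i : 'I_3) (x : 'rV[R]_3), (size s < m)%N ->
     derivable (pderivs s f) x (delta_mx 0 i)) /\
  (forall s : seq 'I_3, (size s <= m)%N -> continuous (pderivs s f)).

(* A covariant [m]-tensor on R^3 is given by its Cartesian components. *)
Definition tensor (R : realType) (m : nat) := m.-tuple 'I_3 -> R.

Definition nabla (R : realType) (m : nat) (f : 'rV[R]_3 -> R) (x : 'rV[R]_3) :
    tensor R m :=
  fun J => pderivs J f x.

Definition eval_tensor (R : realType) (m : nat) (T : tensor R m)
    (a : 'I_m -> 'rV[R]_3) : R :=
  \sum_(J : m.-tuple 'I_3) T J * \prod_(k < m) a k 0 (tnth J k).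

Definition tensor_norm (R : realType) (m : nat) (T : tensor R m) : R :=
  Num.sqrt (\sum_(J : m.-tuple 'I_3) T J ^+ 2).

Definition cyl (R : realType) (r t z : R) : 'rV[R]_3 :=
  vec3 (r * cos t) (r * sin t) z.

Definition e_r (R : realType) (t : R) : 'rV[R]_3 := vec3 (cos t) (sin t) 0.
Definition e_theta (R : realType) (t : R) : 'rV[R]_3 :=
  vec3 (- sin t) (cos t) 0.
Definition e_z (R : realType) : 'rV[R]_3 := vec3 0 0 1.

(* The covariant frame: the partial derivatives of [cyl] in r, theta, z. *)
Definition E_r (R : realType) (t : R) : 'rV[R]_3 := e_r t.
Definition E_theta (R : realType) (r t : R) : 'rV[R]_3 := r *: e_theta t.
Definition E_z (R : realType) : 'rV[R]_3 := e_z R.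

(* The default value [0] of [nth] is never used when
   [2 * mc + mr + mz = m]. *)
Definition slots (R : realType) (m mc mr mz : nat) (a b c : 'rV[R]_3) :
    'I_m -> 'rV[R]_3 :=
  fun k => (nseq (2 * mc) a ++ nseq mr b ++ nseq mz c)`_k.

(* [F] is the expression [f = f(r, z)] in cylindrical coordinates; the values
   [F r z] with [r < 0] are unconstrained. *)
Definition axisymmetric (R : realType) (f : 'rV[R]_3 -> R) (F : R -> R -> R) :
    Prop :=
  forall r t z : R, 0 <= r -> f (cyl r t z) = F r z.

Definition d_r (R : realType) (F : R -> R -> R) : R -> R -> R :=
  fun r z => derive1 (fun s => F s z) r.

Definition d_z (R : realType) (F : R -> R -> R) : R -> R -> R :=
  fun r z => derive1 (fun s => F r s) z.

Definition d_r_over_r (R : realType) (F : R -> R -> R) : R -> R -> R :=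
  fun r z => r^-1 * d_r F r z.

Definition Dop (R : realType) (mc mr mz : nat) (F : R -> R -> R) :
    R -> R -> R :=
  iter mz (@d_z R) (iter mr (@d_r R) (iter mc (@d_r_over_r R) F)).

(* [(2 k - 1)!! = 1 * 3 * ... * (2 k - 1)], with [(-1)!! = 1]. *)
Definition odd_dfact (k : nat) : nat := (\prod_(i < k) (2 * i + 1))%N.

(* Main.v *)
Require Import Defs.
From mathcomp Require Import all_boot all_order all_algebra.
From mathcomp Require Import all_classical all_reals all_analysis.
From mathcomp Require Import ring lra zify.
Import Order.TTheory GRing.Theory Num.Theory numFieldNormedType.Exports.
Local Open Scope classical_set_scope.
Local Open Scope ring_scope.

(** The rotations about the z-axis leave an axisymmetric [f] invariant, so by
    the chain rule evaluating [nabla f] at [cyl r t z] on the cylindrical frame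
    amounts to taking Cartesian partial derivatives at [(r, 0, z)].  Mixed
    partial derivatives commute, hence one may first apply the even power of
    d/dy to [y |-> F (sqrt (r^2 + y^2)) z].  As d/dy of this function is [y]
    times the same composite with [F] replaced by [(d_r F) / r], Leibniz' rule
    at [y = 0] gives [(2k-1)!!] times the [k]-th power of [d_r / r], and zero
    for odd powers; d/dr and d/dz can then be taken inside the half-plane
    [y = 0].  The norm equivalence follows: every Cartesian component of
    [nabla f] at [(r, 0, z)] is zero or a multiple of one [Dop], and a rotation
    distorts the tensor norm by a factor depending only on [m]. *)

(** * Directional and partial derivatives *)

Section DirectionalDerivatives.
Context {R : realType} {V : normedModType R}.
Implicit Types (f : V -> R) (v w x : V).

(** The two difference quotients are the same function of [h], the case [h = 0] matching the base
    values. This transfers derivatives to lines, translates and linear images. *)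
Lemma growth_rate_reparam {W : normedModType R} (g : W -> R) f (y d : W) x v :
    (forall h : R, g (h *: d + y) = f (h *: v + x)) ->
  'D_d g y = 'D_v f x /\ (derivable g y d <-> derivable f x v).
Proof.
move=> gf; rewrite /derive /derivable.
have -> : (fun h : R => h^-1 *: ((g \o shift y) (h *: d) - g y)) =
          (fun h : R => h^-1 *: ((f \o shift x) (h *: v) - f x)).
  apply/funext => h /=; rewrite gf; congr (_ *: (_ - _)).
  by have := gf 0; rewrite !scale0r !add0r.
by split.
Qed.

Lemma derivable_line f x v (s : R) : derivable f (x + s *: v) v ->
  is_derive s 1 (fun u : R => f (x + u *: v)) ('D_v f (x + s *: v)).
Proof.
have shift_line (h : R) : f (x + (h *: 1 + s) *: v) = f (h *: v + (x + s *: v)).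
  by rewrite [h *: 1]mulr1 scalerDl addrCA.
have [E D] := @growth_rate_reparam R (fun u : R => f (x + u *: v)) f s 1
  (x + s *: v) v shift_line.
move=> fv; split; [exact (D.2 fv) | exact E].
Qed.

(** Bounding [c] by absolute values lets one statement cover both signs of [s], as two-sided limits
    in [s] require. *)
Lemma MVT_line f x v (s : R) : (forall u, derivable f (x + u *: v) v) ->
  exists2 c : R, `|c| <= `|s| & f (x + s *: v) - f x = s * 'D_v f (x + c *: v).
Proof.
move=> fv; pose g (u : R) := f (x + u *: v).
have g' (u : R) : is_derive u 1 g ('D_v f (x + u *: v)) by exact: derivable_line.
have gc (i : interval R) : {within [set` i], continuous g}.
  by apply: derivable_within_continuous => u _; case: (g' u).
have g0 : g 0 = f x by rewrite /g scale0r addr0.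
have [s0|s0] := leP 0 s.
  have [c] := MVT_segment s0 (fun u _ => g' u) (gc _).
  rewrite in_itv/= => /andP[c0 cs]; rewrite g0 subr0 mulrC => E.
  by exists c; rewrite // !ger0_norm.
have [c] := MVT_segment (ltW s0) (fun u _ => g' u) (gc _).
rewrite in_itv/= => /andP[c0 cs]; rewrite g0 sub0r => E; exists c.
  by rewrite (ltr0_norm s0) ler0_norm// lerN2.
by rewrite -opprB E mulrN opprK mulrC.
Qed.

Lemma dominated_cvg0 (c : R -> R) (a : R) :
  (forall h, `|c h| <= `|h * a|) -> c h @[h --> (0:R)^'] --> (0:R).
Proof.
move=> ca; apply/cvgr0Pnorm_lt => e e0.
have : h * a @[h --> (0:R)^'] --> (0:R).
  by rewrite -[X in _ --> X](mul0r a); apply: cvgMr_tmp; exact: cvg_within.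
move=> /cvgr0Pnorm_lt/(_ e e0); apply: filterS => h; exact: le_lt_trans.
Qed.

(** The increment is split into a step along [w] and then one along [v]. The mean value theorem
    turns the second step into ['D_v f] at a point tending to [x], where continuity applies. *)
Lemma is_derive_addZ f x w v (a : R) :
    derivable f x w -> (forall y, derivable f y v) ->
    {for x, continuous ('D_v f)} ->
  is_derive x (w + a *: v) f ('D_w f x + a * 'D_v f x).
Proof.
move=> fw fv fc.
have /choice[c cP] : forall h : R, exists c : R, `|c| <= `|h * a| /\
    f (h *: w + x + (h * a) *: v) - f (h *: w + x) =
    h * a * 'D_v f (h *: w + x + c *: v).
  move=> h; have [c] := MVT_line f (h *: w + x) v (h * a) (fun u => fv _).
  by exists c.
have c0 : c h @[h --> (0:R)^'] --> (0:R).
  by apply: (@dominated_cvg0 _ a) => h; case: (cP h).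
have pc : h *: w + x + c h *: v @[h --> (0:R)^'] --> x.
  rewrite -[X in _ --> X]addr0 -[X in _ --> X + _]add0r.
  apply: cvgD; first apply: cvgD; last first.
  - by rewrite -[X in _ --> X](scale0r v); apply: cvgZr_tmp.
  - exact: cvg_cst.
  - rewrite -[X in _ --> X](scale0r w); apply: cvgZr_tmp => //.
    exact: cvg_within.
have lim : h^-1 *: ((f \o shift x) (h *: (w + a *: v)) - f x) @[h --> (0:R)^']
    --> 'D_w f x + a * 'D_v f x.
  have : h^-1 *: ((f \o shift x) (h *: w) - f x) +
         a * 'D_v f (h *: w + x + c h *: v) @[h --> (0:R)^']
      --> 'D_w f x + a * 'D_v f x.
    apply: cvgD; first exact: fw.
    apply: cvgMl_tmp; exact: (cvg_comp _ _ pc fc).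
  apply: cvg_trans; apply: near_eq_cvg; near=> h.
  have h0 : h != 0 by near: h; exact: nbhs_dnbhs_neq.
  have [_ E] := cP h.
  have -> : (f \o shift x) (h *: (w + a *: v)) = f (h *: w + x + (h * a) *: v).
    by rewrite /= scalerDr scalerA addrAC.
  have quotient (A B C D : R) :
      A - B = h * a * D -> h^-1 * (B - C) + a * D = h^-1 * (A - C).
    by move=> AB; rewrite -[A](subrK B) AB; field.
  exact: quotient E.
by apply: DeriveDef;  [apply/cvg_ex; eexists; exact: lim | exact: cvg_lim].
Unshelve. all: by end_near. Qed.

(** The second difference of [f] over the parallelogram spanned by [s *: v] and [s *: w]; its
    symmetry in [v] and [w] is the source of Schwarz' theorem. *)
Let double_difference f x v w (s : R) :=
  f (x + s *: v + s *: w) - f (x + s *: v) - (f (x + s *: w) - f x).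

(** The mean value theorem is applied twice: along [v] to the difference of [f] and its translate by
    [s *: w], then along [w] to ['D_v f]. *)
Lemma double_differenceE f x v w (s : R) :
    (forall y, derivable f y v) -> (forall y, derivable ('D_v f) y w) ->
  exists cd : R * R, [/\ `|cd.1| <= `|s|, `|cd.2| <= `|s| &
    double_difference f x v w s =
    s * (s * 'D_w ('D_v f) (x + cd.1 *: v + cd.2 *: w))].
Proof.
move=> fv fvw; pose g y := f (y + s *: w) - f y.
have gv y : is_derive y v g ('D_v f (y + s *: w) - 'D_v f y).
  have [E D] := @growth_rate_reparam V (fun y => f (y + s *: w)) f y v (y + s *: w) v
    (fun h => ltac:(by rewrite /= addrA)).
  rewrite -E; apply: is_deriveB; apply: derivableP => //; exact/D.
have [c cs E] := @MVT_line g x v s (fun u => let: DeriveDef d _ := gv (x + u *: v) in d).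
have [d ds E'] := @MVT_line ('D_v f) (x + c *: v) w s (fun u => fvw _).
exists (c, d); split => //.
by rewrite -E' /double_difference -/(g _) -/(g _) E; case: (gv (x + c *: v)) => _ ->.
Qed.

Lemma double_difference_cvg f x v w :
    (forall y, derivable f y v) -> (forall y, derivable ('D_v f) y w) ->
    {for x, continuous ('D_w ('D_v f))} ->
  s^-1 * (s^-1 * double_difference f x v w s) @[s --> (0:R)^'] -->
    'D_w ('D_v f) x.
Proof.
move=> fv fvw fc.
have /choice[c cP] : forall s : R, exists cd : R * R,
    [/\ `|cd.1| <= `|s|, `|cd.2| <= `|s| & double_difference f x v w s =
      s * (s * 'D_w ('D_v f) (x + cd.1 *: v + cd.2 *: w))].
  by move=> s; exact: double_differenceE.
have sq (u : R -> R) : (forall s, `|u s| <= `|s|) -> u s @[s --> (0:R)^'] --> (0:R).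
 
  move=> us; apply: norm_cvg0; apply: (@squeeze_cvgr _ _ _ _ (fun=> 0) (fun h => `|h|)).
  - by apply: nearW => h; rewrite normr_ge0 us.
  - exact: cvg_cst.
  - rewrite -[X in _ --> X](@normr0 _ R); apply: cvg_norm.
    exact: cvg_within.
have pc : x + (c s).1 *: v + (c s).2 *: w @[s --> (0:R)^'] --> x.
  rewrite -[X in _ --> X]addr0 -[X in _ --> X + _]addr0.
  apply: cvgD; first apply: cvgD.
  - exact: cvg_cst.
  - rewrite -[X in _ --> X](scale0r v); apply: cvgZr_tmp; apply: sq => s.
    by case: (cP s).
  - rewrite -[X in _ --> X](scale0r w); apply: cvgZr_tmp; apply: sq => s.
    by case: (cP s).
apply: cvg_trans (cvg_comp _ _ pc fc); apply: near_eq_cvg; near=> s.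
have s0 : s != 0 by near: s; exact: nbhs_dnbhs_neq.
by have [_ _ ->] := cP s; rewrite mulKf// mulKf.
Unshelve. all: by end_near. Qed.

(** Both mixed derivatives are limits of the same symmetric second difference divided by [s]
    twice. *)
Lemma derive_comm f x v w :
    (forall y, derivable f y v) -> (forall y, derivable f y w) ->
    (forall y, derivable ('D_v f) y w) -> (forall y, derivable ('D_w f) y v) ->
    {for x, continuous ('D_w ('D_v f))} -> {for x, continuous ('D_v ('D_w f))} ->
  'D_w ('D_v f) x = 'D_v ('D_w f) x.
Proof.
move=> fv fw fvw fwv cvw cwv.
have dd_sym (s : R) : double_difference f x w v s = double_difference f x v w s.
  by rewrite /double_difference [x + _ + _]addrAC; ring.
have := double_difference_cvg f x w v fw fwv cwv.
under eq_fun do rewrite dd_sym.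
move=> cwv'; have cvw' := double_difference_cvg f x v w fv fvw cvw.
exact: (cvg_unique _ cvw' cwv').
Qed.

End DirectionalDerivatives.

Lemma is_derive_bigsum {R : realType} {V : normedModType R} {I : Type} (r : seq I)
    (F : I -> V -> R) (dF : I -> R) (x v : V) :
    (forall i, is_derive x v (F i) (dF i)) ->
  is_derive x v (fun y => \sum_(i <- r) F i y) (\sum_(i <- r) dF i).
Proof.
move=> FdF; elim: r => [|i r IH].
  rewrite big_nil; under eq_fun do rewrite big_nil.
  exact: is_derive_cst.
rewrite big_cons; under eq_fun do rewrite big_cons.
exact: is_deriveD.
Qed.

Lemma big_tuple_cons {R : nmodType} (T : finType) (n : nat)
    (F : n.+1.-tuple T -> R) :
  \sum_(K : n.+1.-tuple T) F K =
  \sum_(K : n.-tuple T) \sum_(i : T) F [tuple of i :: K].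
Proof.
rewrite pair_big /=.
rewrite (reindex (fun p : n.-tuple T * T => [tuple of p.2 :: p.1])) //=.
exists (fun K : n.+1.-tuple T => (behead_tuple K, thead K)) => [[K i] _|K _] /=.
  by congr (_, _); apply: val_inj.
by rewrite [RHS]tuple_eta.
Qed.

(** * Linear change of variables and symmetry for iterated partial derivatives *)

Section PartialDerivatives.
Context {R : realType}.
Implicit Types (f : 'rV[R]_3 -> R) (s : seq 'I_3) (x v : 'rV[R]_3).

Lemma is_derive_pderivs m f s x v : Ck m f -> (size s < m)%N ->
  is_derive x v (pderivs s f) (\sum_(i < 3) v 0 i * pderivs (i :: s) f x).
Proof.
move=> [fd fc] sm; rewrite [v in is_derive _ v](row_sum_delta v).
(* Coordinate directions are added one at a time: the partial sum is the [w] of [is_derive_addZ],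
   and the new basis vector, whose partial derivative is continuous, is its [v]. *)
elim: (index_enum _) => [|i r IH].
  by rewrite !big_nil; exact: is_derive0.
rewrite !big_cons addrC [_ * _ + _]addrC.
have [IHd <-] := IH.
apply (is_derive_addZ _ _ _ _ _ IHd); first by move=> y; exact: fd.
exact: (fc (i :: s)).
Qed.

(** Each new derivative along the [i]-th basis vector becomes one along row [i] of [M], which
    [is_derive_pderivs] expands into partial derivatives. *)
Lemma pderivs_mulmx m f (M : 'M[R]_3) n (J : n.-tuple 'I_3) x :
    Ck m f -> (n <= m)%N ->
  pderivs J (fun y => f (y *m M)) x =
  \sum_(K : n.-tuple 'I_3)
    (\prod_(k < n) M (tnth J k) (tnth K k)) * pderivs K f (x *m M).
Proof.
move=> Cf; elim: n J x => [|n IH] J x nm.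
  rewrite (big_pred1 [tuple]) => [|K]; last first.
    by apply/esym/eqP/val_inj; case: K => -[].
  by rewrite (tuple0 J) big_ord0 mul1r.
case/tupleP: J => i J.
have -> : pderivs (i :: J) (fun y => f (y *m M)) =
    pderiv i (fun y => \sum_(K : n.-tuple 'I_3)
      (\prod_(k < n) M (tnth J k) (tnth K k)) * pderivs K f (y *m M)).
  by rewrite /=; congr pderiv; apply/funext => y; apply: IH; exact: ltnW.
rewrite big_tuple_cons /pderiv.
apply: (@derive_val _ _ _ _ _ _ _ (is_derive_bigsum _ _ _ _ _ _)) => K.
have -> : \sum_(j < 3) (\prod_(k < n.+1)
    M (tnth [tuple of i :: J] k) (tnth [tuple of j :: K] k)) *
      pderivs [tuple of j :: K] f (x *m M) =
    (\prod_(k < n) M (tnth J k) (tnth K k)) *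
      \sum_(j < 3) row i M 0 j * pderivs (j :: K) f (x *m M).
  rewrite mulr_sumr; apply: eq_bigr => j _.
  rewrite big_ord_recl !tnth0 mxE mulrCA mulrA; congr (_ * _ * _).
  by apply: eq_bigr => k _; rewrite !tnthS.
have shift_mulmx (h : R) :
    pderivs K f ((h *: delta_mx 0 i + x) *m M) = pderivs K f (h *: row i M + x *m M).
  by rewrite mulmxDl -scalemxAl -rowE.
have [E D] := @growth_rate_reparam R 'rV[R]_3 'rV[R]_3
  (fun y => pderivs K f (y *m M)) (pderivs K f) x (delta_mx 0 i) (x *m M)
  (row i M) shift_mulmx.
have sK : (size K < m)%N by rewrite size_tuple.
have [dK EK] := is_derive_pderivs _ _ _ (x *m M) (row i M) Cf sK.
apply: is_deriveZ; split; first exact (D.2 dK).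
by rewrite E EK.
Qed.

Lemma pderivs_swap m f s (i j : 'I_3) : Ck m f -> ((size s).+2 <= m)%N ->
  pderivs (i :: j :: s) f = pderivs (j :: i :: s) f.
Proof.
move=> [fd fc] sm; apply/funext => x; have sm' := ltnW sm.
exact (derive_comm (pderivs s f) x (delta_mx 0 j) (delta_mx 0 i)
  (fun y => fd s j y sm') (fun y => fd s i y sm')
  (fun y => fd (j :: s) i y sm) (fun y => fd (i :: s) j y sm)
  (fc (i :: j :: s) sm x) (fc (j :: i :: s) sm x)).
Qed.

Lemma pderivs_perm m f s1 s2 : Ck m f -> (size s1 <= m)%N -> perm_eq s1 s2 ->
  pderivs s1 f = pderivs s2 f.
Proof.
(* Adjacent swaps carry a head letter past a prefix, so the head of [s1] can be matched with its
   occurrence in [s2]. *)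
move=> Cf; have move_front i s t : (size (i :: s ++ t) <= m)%N ->
    pderivs (i :: s ++ t) f = pderivs (s ++ i :: t) f.
  elim: s => //= j s IH sm; rewrite -IH; last exact: ltnW.
  exact: (pderivs_swap m f (s ++ t)).
elim: s1 s2 => [|i s1 IH] s2 sm p.
  by move: p; rewrite perm_sym => /perm_nilP ->.
have is2 : i \in s2 by rewrite -(perm_mem p) mem_head.
case/path.splitPr: is2 p => t1 t2 p.
have p' : perm_eq s1 (t1 ++ t2).
  by move: p; rewrite perm_sym perm_catC /= perm_cons perm_catC perm_sym.
rewrite -move_front /=; last by rewrite -(perm_size p').
by rewrite (IH (t1 ++ t2)) // ltnW.
Qed.

End PartialDerivatives.

(** * Even functions of one variable *)

Section RadialProfile.
Context {R : realType}.
Implicit Types (f g phi : R -> R) (U : set R) (n k : nat) (a x y : R).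

(** The set [U] is there because the radial profile is differentiated only at positive radii;
    derivatives are total functions whose values off [U] carry no information. *)
Fixpoint derivable_upto n U f : Prop :=
  if n is n'.+1 then
    (forall x, U x -> derivable f x 1) /\ derivable_upto n' U f^`()%classic
  else True.

Lemma derivable_uptoW n U f : derivable_upto n.+1 U f -> derivable_upto n U f.
Proof.
elim: n f => // n IH f [df dnf]; split => //; exact: IH.
Qed.

Lemma derivable_upto_nth n U f k x : derivable_upto n U f -> (k < n)%N -> U x ->
  derivable f^`(k)%classic x 1.
Proof.
elim: k n f => [|k IH] [//|n] f [df dnf] kn Ux; first exact: df.
by rewrite derive1Sn; exact: (IH n).
Qed.

Lemma near_open_eq U f g x : open U -> (forall y, U y -> f y = g y) -> U x ->
  \near x, f x = g x.
Proof.
by move=> oU fg Ux; apply: filterS (open_nbhs_nbhs (conj oU Ux)).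
Qed.

Lemma derivable_upto_ext n U f g : open U -> (forall x, U x -> f x = g x) ->
  derivable_upto n U f -> derivable_upto n U g.
Proof.
move=> oU; elim: n f g => // n IH f g fg [df dnf]; split=> [x Ux|].
  exact: (near_eq_derivable (near_open_eq U f g x oU fg Ux) (df x Ux)).
apply: IH dnf => x Ux; rewrite !derive1E; apply: near_eq_derive.
exact: near_open_eq oU fg Ux.
Qed.

Lemma derivable_upto_subset n U V f : (forall x, U x -> V x) ->
  derivable_upto n V f -> derivable_upto n U f.
Proof.
move=> UV; elim: n f => // n IH f [df dnf]; split; last exact: IH.
by move=> x /UV; exact: df.
Qed.

Lemma derivable_uptoS n U f df : open U ->
    (forall x, U x -> is_derive x 1 f (df x)) -> derivable_upto n U df ->
  derivable_upto n.+1 U f.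
Proof.
move=> oU fdf dnf; split=> [x Ux|]; first by case: (fdf x Ux).
apply: derivable_upto_ext dnf => // x Ux.
by rewrite derive1E; case: (fdf x Ux).
Qed.

Lemma derivable_upto_is_derive n U f x : derivable_upto n.+1 U f -> U x ->
  is_derive x 1 f (f^`()%classic x).
Proof.
by move=> [df _] Ux; rewrite derive1E; apply: derivableP; exact: df.
Qed.

Lemma derivable_upto_cst n U (c : R) : open U -> derivable_upto n U (fun=> c).
Proof.
move=> oU; elim: n c => // n IH c.
by apply: (derivable_uptoS _ _ _ (fun=> 0)) => //.
Qed.

Lemma derivable_upto_id n U : open U -> derivable_upto n U (fun x => x).
Proof.
case: n => // n oU; apply: (derivable_uptoS _ _ _ (fun=> 1)) => //.
exact: derivable_upto_cst.
Qed.

Lemma derivable_uptoD n U f g : open U ->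
  derivable_upto n U f -> derivable_upto n U g ->
  derivable_upto n U (fun x => f x + g x).
Proof.
move=> oU; elim: n f g => // n IH f g df dg.
refine (derivable_uptoS n U (fun x => f x + g x)
  (fun x => f^`()%classic x + g^`()%classic x) oU _ _).
  by move=> x Ux; apply: is_deriveD; exact: (derivable_upto_is_derive n U).
by apply: IH; [case: df | case: dg].
Qed.

Lemma is_derive_mul f g x (df dg : R) : is_derive x 1 f df ->
  is_derive x 1 g dg -> is_derive x 1 (fun x => f x * g x) (f x * dg + g x * df).
Proof. exact: is_deriveM. Qed.

Lemma derivable_uptoM n U f g : open U ->
  derivable_upto n U f -> derivable_upto n U g ->
  derivable_upto n U (fun x => f x * g x).
Proof.
move=> oU; elim: n f g => // n IH f g df dg.
apply: (derivable_uptoS _ _ _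
  (fun x => f x * g^`()%classic x + g x * f^`()%classic x)) => //.
  by move=> x Ux; apply: is_derive_mul; exact: (derivable_upto_is_derive n U).
have [df1 dg1] := (derivable_uptoW _ _ _ df, derivable_uptoW _ _ _ dg).
by apply: derivable_uptoD => //; apply: IH => //; [case: dg | case: df].
Qed.

Let pos : set R := [set x | 0 < x].

(** The derivative is minus the square of the function itself, so the product rule closes the
    induction. *)
Lemma derivable_upto_inv n : derivable_upto n pos (fun x => x^-1).
Proof.
have opos : open pos by exact: open_gt.
elim: n => // n IH.
apply: (derivable_uptoS _ _ _ (fun x => -1 * (x^-1 * x^-1))) => //.
  move=> x x0; have xN0 : x != 0 by rewrite gt_eqF.
  have dV := derivableV xN0 (@derivable_id R R x 1).
  split=> //; rewrite (deriveV xN0 (@derivable_id R R x 1)) derive_id.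
  by rewrite expr2 invfM [_ *: _]mulr1 mulN1r.
apply: derivable_uptoM; [by []| exact: derivable_upto_cst|].
exact: derivable_uptoM.
Qed.

(** This is [d_r_over_r] at a frozen [z], as [iter_d_r_over_r] makes precise. *)
Definition radial_derive phi : R -> R := fun s => s^-1 * phi^`()%classic s.

Lemma derivable_upto_radial_derive n phi : derivable_upto n.+1 pos phi ->
  derivable_upto n pos (radial_derive phi).
Proof.
move=> [_ dphi]; apply: derivable_uptoM; [exact: open_gt| |by []].
exact: derivable_upto_inv.
Qed.

Let radius a y : R := Num.sqrt (a ^+ 2 + y ^+ 2).

Lemma radius_gt0 a y : 0 < a -> 0 < radius a y.
Proof.
by move=> a0; rewrite sqrtr_gt0 ltr_pwDl ?exprn_gt0// sqr_ge0.
Qed.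

Lemma is_derive_radius_comp n phi a y : 0 < a -> derivable_upto n.+1 pos phi ->
  is_derive y 1 (fun y => phi (radius a y)) (y * radial_derive phi (radius a y)).
Proof.
move=> a0 dphi; have r0 := radius_gt0 a y a0.
have ay0 : 0 < a ^+ 2 + y ^+ 2 by rewrite -sqrtr_gt0.
have dq : is_derive y 1 (fun y : R => a ^+ 2 + y ^+ 2) (2 * y).
  have d1 := is_derive_mul _ _ _ _ _ (is_derive_id y 1) (is_derive_id y 1).
  have := is_deriveD (is_derive_cst (a ^+ 2) y 1) d1.
  by move/is_derive_eq; apply; rewrite /=; ring.
have ds := @is_derive1_comp _ Num.sqrt (fun y => a ^+ 2 + y ^+ 2) y _ _
  (is_derive1_sqrt ay0) dq.
have := @is_derive1_comp _ phi (radius a) y _ _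
  (derivable_upto_is_derive n pos phi (radius a y) dphi r0) ds.
move/is_derive_eq; apply; rewrite /radial_derive -/(radius a y).
by field; rewrite gt_eqF.
Qed.

(** As [a > 0], the radius stays positive even at [y = 0], so the composite is regular on the whole
    line. Its derivative is [y] times a composite of the same kind, hence the induction over all
    [phi]. *)
Lemma derivable_upto_radius n phi a : 0 < a -> derivable_upto n pos phi ->
  derivable_upto n setT (fun y => phi (radius a y)).
Proof.
move=> a0; elim: n phi => // n IH phi dphi.
apply: derivable_uptoS; first exact: openT.
  by move=> y _; exact: is_derive_radius_comp a0 dphi.
apply: derivable_uptoM; first exact: openT.
  by apply: derivable_upto_id; exact: openT.
by apply: IH; exact: derivable_upto_radial_derive.
Qed.

(** Leibniz' rule has only two terms because the identity has zero second derivative. At [n = 0] the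
    truncated [n.-1] is harmless, its coefficient being [0]. *)
Lemma derive1n_mul_id n g : derivable_upto n setT g ->
  (fun y => y * g y)^`(n)%classic =
  (fun y => y * g^`(n)%classic y + n%:R * g^`(n.-1)%classic y).
Proof.
elim: n => [|n IH] dg; first by apply/funext => y; rewrite mul0r addr0.
rewrite derive1nS IH; last exact: derivable_uptoW.
apply/funext => y; rewrite derive1E.
have dk k : (k < n.+1)%N -> is_derive y 1 g^`(k)%classic (g^`(k.+1)%classic y).
  move=> kn; rewrite derive1nS derive1E; apply: derivableP.
  exact: (derivable_upto_nth n.+1 setT).
have d1 := is_derive_mul _ _ _ _ _ (is_derive_id y 1) (dk n (ltnSn n)).
have d2 : is_derive y 1 (fun y => n%:R * g^`(n.-1)%classic y) (n%:R * g^`(n)%classic y).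
  case: n dk {IH d1 dg} => [|n] dk.
    by rewrite mul0r; under eq_fun do rewrite mul0r; exact: is_derive_cst.
  by apply: is_deriveZ; apply: dk.
have [_ ->] := is_deriveD d1 d2.
by rewrite -natr1; ring.
Qed.

(* The first derivative of [phi (radius a y)] in [y] is [y] times the composite
   of [radius a] with [radial_derive phi]; iterate with Leibniz' rule at 0. *)
Lemma derive1n_radius n phi a : 0 < a -> derivable_upto n pos phi ->
  (fun y => phi (radius a y))^`(n)%classic 0 =
  if odd n then 0 else (odd_dfact n./2)%:R * iter n./2 radial_derive phi a.
Proof.
move=> a0.
have D1 k psi : derivable_upto k.+1 pos psi ->
    (fun y => psi (radius a y))^`()%classic =
    (fun y => y * radial_derive psi (radius a y)).
  move=> dpsi; apply/funext => y; rewrite derive1E.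
  by have [] := is_derive_radius_comp k psi a y a0 dpsi.
(* Strong induction in steps of two: a pair of [y]-derivatives at [0] trades [phi] for
   [radial_derive phi]. *)
have [N nN] := ubnP n; elim: N n phi nN => // N IH [|[|n]] phi nN dphi.
- rewrite /= /odd_dfact big_ord0 mul1r /radius expr0n addr0 sqrtr_sqr ger0_norm//.
  exact: ltW.
- by rewrite derive1n1 (D1 0) // mul0r.
rewrite derive1Sn (D1 n.+1) // derive1n_mul_id; last first.
  by apply: derivable_upto_radius => //; exact: derivable_upto_radial_derive.
rewrite mul0r add0r /= IH; last 2 first.
- by rewrite ltnW.
- by apply: derivable_uptoW; exact: derivable_upto_radial_derive.
rewrite negbK; case: ifPn => [|nodd]; first by rewrite mulr0.
(* For even [n] the Leibniz coefficient [n.+1] equals [2 * n./2 + 1], the last factor of the next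
   odd double factorial. *)
rewrite mulrA -natrM /odd_dfact big_ord_recr /= -iterSr mulnC; congr (_%:R * _).
by congr (_ * _)%N; rewrite addn1 mul2n -[in LHS](odd_double_half n) (negbTE nodd).
Qed.

End RadialProfile.

(** * Cylindrical frame and the half-plane y = 0 *)

Section CylindricalFrame.
Context {R : realType}.
Implicit Types (f : 'rV[R]_3 -> R) (F : R -> R -> R) (r t z : R).

Definition ox : 'I_3 := @Ordinal 3 0 isT.
Definition oy : 'I_3 := @Ordinal 3 1 isT.
Definition oz : 'I_3 := @Ordinal 3 2 isT.

(* Ordered so that at [t = 0] the frame is the Cartesian basis. *)
Definition frame t (i : 'I_3) : 'rV[R]_3 := [:: e_r t; e_theta t; e_z R]`_i.

(** The frame vectors are the rows, so right multiplication rotates a row vector by [t] about the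
    z-axis. *)
Definition frame_mx t : 'M[R]_3 := \matrix_(i, j) frame t i 0 j.

Lemma vec3_frame_mx (a b c t : R) :
  vec3 a b c *m frame_mx t = vec3 (a * cos t - b * sin t) (a * sin t + b * cos t) c.
Proof.
apply/rowP => -[[|[|[|//]]] ?]; rewrite !mxE !big_ord_recl.
all: rewrite big_ord0 !mxE /frame /= ?mxE /=.
all: ring.
Qed.

Lemma cyl_frame_mx r s t z : cyl r s z *m frame_mx t = cyl r (s + t) z.
Proof. by rewrite vec3_frame_mx /cyl cosD sinD; congr vec3; ring. Qed.

Lemma cyl0 r z : cyl r 0 z = vec3 r 0 z.
Proof. by rewrite /cyl cos0 sin0 mulr1 mulr0. Qed.

Lemma frame_mx_le1 t i j : `|frame_mx t i j| <= 1.
Proof.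
have [c1 s1] : `|cos t| <= 1 /\ `|sin t| <= 1.
  by rewrite !ler_norml cos_geN1 cos_le1 sin_geN1 sin_le1.
rewrite mxE /frame; case: i => -[|[|[|//]]] ?; case: j => -[|[|[|//]]] ?;
  by rewrite !mxE /= ?normrN ?normr0 ?normr1.
Qed.

(** The angle is [acos (a / rho)] or its opposite, according to the sign of [b]; at the origin any
    angle serves. Hence [axisymmetric], stated on points [cyl r t z], reaches every point. *)
Lemma polar_coordinates (a b : R) : exists t,
  a = Num.sqrt (a ^+ 2 + b ^+ 2) * cos t /\ b = Num.sqrt (a ^+ 2 + b ^+ 2) * sin t.
Proof.
set rho := Num.sqrt _.
have rho2 : rho ^+ 2 = a ^+ 2 + b ^+ 2 by rewrite sqr_sqrtr// addr_ge0// sqr_ge0.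
have [rho0|rho0] := eqVneq rho 0.
  move: rho2; rewrite rho0 expr0n => /esym/eqP.
  rewrite paddr_eq0 ?sqr_ge0// !sqrf_eq0 => /andP[/eqP-> /eqP->].
  by exists 0; rewrite !mul0r.
have rho_gt0 : 0 < rho by rewrite lt_neqAle eq_sym rho0 sqrtr_ge0.
have a_rho : -1 <= a / rho <= 1.
  rewrite -ler_norml normrM normfV (gtr0_norm rho_gt0) ler_pdivrMr// mul1r.
  rewrite -[leRHS](gtr0_norm rho_gt0) -ler_sqr ?nnegrE// !real_normK ?num_real//.
  by rewrite rho2 lerDl sqr_ge0.
have cosa : cos (acos (a / rho)) = a / rho by rewrite acosK.
have sina : rho * sin (acos (a / rho)) = `|b|.
  rewrite sin_acos// -{1}(gtr0_norm rho_gt0) -sqrtr_sqr -sqrtrM ?sqr_ge0//.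
  rewrite -sqrtr_sqr; congr Num.sqrt.
  by rewrite -[b ^+ 2](addKr (a ^+ 2)) -rho2; field.
have [b0|b0] := leP 0 b.
  exists (acos (a / rho)); rewrite cosa sina ger0_norm//.
  by split=> //; field.
exists (- acos (a / rho)); rewrite cosN sinN cosa mulrN sina ltr0_norm// opprK.
by split=> //; field.
Qed.

Lemma axisymmetric_vec3 f F (a b c : R) : axisymmetric f F ->
  f (vec3 a b c) = F (Num.sqrt (a ^+ 2 + b ^+ 2)) c.
Proof.
move=> fF; have [t [aE bE]] := polar_coordinates a b.
by rewrite -(fF _ t) ?sqrtr_ge0// /cyl -aE -bE.
Qed.

Lemma row3E (x : 'rV[R]_3) : x = vec3 (x 0 ox) (x 0 oy) (x 0 oz).
Proof.
by apply/rowP => -[[|[|[|//]]] ?]; rewrite !mxE /=; congr (x 0 _); exact: val_inj.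
Qed.

Lemma axisymmetric_frame_mx f F t : axisymmetric f F ->
  (fun x => f (x *m frame_mx t)) = f.
Proof.
move=> fF; apply/funext => x; rewrite (row3E x) vec3_frame_mx.
rewrite !(axisymmetric_vec3 _ _ _ _ _ fF); congr (F (Num.sqrt _) _).
by have := cos2Dsin2 t => E; rewrite -[RHS]mulr1 -E; ring.
Qed.

(** Differentiating the invariance of [f] under [frame_mx t] at [(r, 0, z)] produces exactly the
    contraction with the frame at [cyl r t z]. *)
Lemma eval_frame m f F (J : m.-tuple 'I_3) r t z : Ck m f -> axisymmetric f F ->
  eval_tensor (nabla f (cyl r t z)) (fun k => frame t (tnth J k)) =
  nabla f (vec3 r 0 z) J.
Proof.
move=> Cf fF; rewrite /nabla -[in RHS](axisymmetric_frame_mx f F t fF).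
rewrite (pderivs_mulmx m f _ m J _ Cf)// -cyl0 cyl_frame_mx add0r.
apply: eq_bigr => K _; rewrite mulrC; congr (_ * _).
by apply: eq_bigr => k _; rewrite mxE.
Qed.

(** A common form for the lines parallel to the three axes, shaped to meet the hypothesis of
    [growth_rate_reparam]. *)
Definition coordinate_line (i : 'I_3) (p : R -> 'rV[R]_3) : Prop :=
  forall h a : R, p (h + a) = h *: delta_mx 0 i + p a.

Lemma coordinate_line_x (b c : R) : coordinate_line ox (fun s => vec3 s b c).
Proof.
by move=> h a; apply/rowP => -[[|[|[|//]]] ?]; rewrite !mxE /= ?mulr1 ?mulr0 ?add0r.
Qed.

Lemma coordinate_line_y (a c : R) : coordinate_line oy (fun s => vec3 a s c).
Proof.
by move=> h b; apply/rowP => -[[|[|[|//]]] ?]; rewrite !mxE /= ?mulr1 ?mulr0 ?add0r.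
Qed.

Lemma coordinate_line_z (a b : R) : coordinate_line oz (fun s => vec3 a b s).
Proof.
by move=> h c; apply/rowP => -[[|[|[|//]]] ?]; rewrite !mxE /= ?mulr1 ?mulr0 ?add0r.
Qed.

Lemma derive1_line f i p (a : R) : coordinate_line i p ->
  (fun s => f (p s))^`()%classic a = pderiv i f (p a).
Proof.
move=> pi; have shift_line (h : R) : f (p (h *: 1 + a)) = f (h *: delta_mx 0 i + p a).
  by rewrite -pi [h *: 1]mulr1.
rewrite derive1E.
exact (@growth_rate_reparam R 'rV[R]_3 R (fun s => f (p s)) f a 1 (p a)
  (delta_mx 0 i) shift_line).1.
Qed.

Lemma is_derive_line f i p (a : R) : coordinate_line i p ->
  derivable f (p a) (delta_mx 0 i) ->
  is_derive a 1 (fun s => f (p s)) (pderiv i f (p a)).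
Proof.
move=> pi df; rewrite -(derive1_line f i p a pi) derive1E.
have shift_line (h : R) : f (p (h *: 1 + a)) = f (h *: delta_mx 0 i + p a).
  by rewrite -pi [h *: 1]mulr1.
apply: derivableP.
exact ((@growth_rate_reparam R 'rV[R]_3 R (fun s => f (p s)) f a 1 (p a)
  (delta_mx 0 i) shift_line).2.2 df).
Qed.

Lemma derive1n_line f i p k : coordinate_line i p ->
  (fun s => f (p s))^`(k)%classic = fun s => pderivs (nseq k i) f (p s).
Proof.
move=> pi; elim: k => // k IH; rewrite derive1nS IH.
by apply/funext => a; rewrite (derive1_line (pderivs (nseq k i) f) i p a pi).
Qed.

Lemma derivable_upto_line m f i p n s : Ck m f -> coordinate_line i p ->
  (size s + n <= m)%N ->
  derivable_upto n setT (fun a => pderivs s f (p a)).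
Proof.
move=> [fd fc] pi; elim: n s => // n IH s sn.
have sm : (size s < m)%N by apply: leq_trans sn; rewrite addnS ltnS leq_addr.
apply (derivable_uptoS n setT _ (fun a => pderivs (i :: s) f (p a)) openT).
  by move=> a _; apply: (is_derive_line (pderivs s f) i p a pi); exact: fd.
by apply: IH; rewrite addSnnS.
Qed.

(** The condition is imposed on the open set [0 < r] only, so it survives differentiation in [r] and
    in [z]; each such derivative prepends a letter to [s] and keeps [c]. *)
Definition halfplane_multiple f s (c : R) (H : R -> R -> R) : Prop :=
  forall r z, 0 < r -> H r z = c * pderivs s f (vec3 r 0 z).

Lemma derive1_scale_line f i p (c a : R) : coordinate_line i p ->
  derivable f (p a) (delta_mx 0 i) ->
  (fun s => c * f (p s))^`()%classic a = c * pderiv i f (p a).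
Proof.
move=> pi df; rewrite derive1E.
by have [_ ->] := is_deriveZ c (is_derive_line f i p a pi df).
Qed.

Lemma halfplane_multiple_d_r m f s c H : Ck m f -> (size s < m)%N ->
  halfplane_multiple f s c H -> halfplane_multiple f (ox :: s) c (d_r H).
Proof.
move=> [fd fc] sm fH r z r0.
have := derive1_scale_line (pderivs s f) ox _ c r (coordinate_line_x 0 z) (fd _ _ _ sm).
move=> <-; rewrite /d_r !derive1E; apply: near_eq_derive.
apply (near_open_eq [set x : R | 0 < x] (fun s => H s z)
  (fun x => c * pderivs s f (vec3 x 0 z)) r (@open_gt _ 0) (fun x => fH x z) r0).
Qed.

Lemma halfplane_multiple_d_z m f s c H : Ck m f -> (size s < m)%N ->
  halfplane_multiple f s c H -> halfplane_multiple f (oz :: s) c (d_z H).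
Proof.
move=> [fd fc] sm fH r z r0.
have := derive1_scale_line (pderivs s f) oz _ c z (coordinate_line_z r 0) (fd _ _ _ sm).
by move=> <-; rewrite /d_z; congr (derive1 _ z); apply/funext => y; rewrite fH.
Qed.

Lemma halfplane_multiple_iter m f s c H cx cz : Ck m f ->
  (size s + cx + cz <= m)%N -> halfplane_multiple f s c H ->
  halfplane_multiple f (nseq cz oz ++ nseq cx ox ++ s) c
    (iter cz (@d_z R) (iter cx (@d_r R) H)).
Proof.
move=> Cf sm fH; elim: cz sm => [|cz IH] sm /=.
  rewrite addn0 in sm; elim: cx sm => [|cx IH] sm //=.
  apply: (halfplane_multiple_d_r m) => //.
    by rewrite size_cat size_nseq addnC; move: sm; rewrite addnS.
  by apply: IH; rewrite ltnW// -addnS.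
apply: (halfplane_multiple_d_z m) => //.
  by rewrite !size_cat !size_nseq addnC (addnC cx); move: sm; rewrite addnS.
by apply: IH; rewrite ltnW// -addnS.
Qed.

Lemma iter_d_r_over_r k F r z :
  iter k (@d_r_over_r R) F r z = iter k radial_derive (fun s => F s z) r.
Proof.
elim: k r => //= k IH r; rewrite [LHS]/d_r_over_r /d_r.
by have -> : (fun s => iter k (@d_r_over_r R) F s z) =
    iter k radial_derive (fun s => F s z) by apply/funext.
Qed.

Lemma pderivs_nseq_y m f F k r z : Ck m f -> axisymmetric f F -> (k <= m)%N ->
  0 < r ->
  pderivs (nseq k oy) f (vec3 r 0 z) =
  if odd k then 0 else (odd_dfact k./2)%:R * iter k./2 (@d_r_over_r R) F r z.
Proof.
move=> Cf fF km r0.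
have /(congr1 (@^~ 0))/= <- := derive1n_line f oy _ k (coordinate_line_y r z).
have -> : (fun y => f (vec3 r y z)) = (fun y => F (Num.sqrt (r ^+ 2 + y ^+ 2)) z).
  by apply/funext => y; exact: axisymmetric_vec3.
rewrite iter_d_r_over_r (derive1n_radius k (fun s => F s z))//.
(* The regularity of [F] in its first variable is inherited from [f] along a line parallel to the
   x-axis, where the two agree for positive abscissa. *)
apply: (derivable_upto_ext _ _ (fun s => f (vec3 s 0 z))); first exact: open_gt.
  move=> s s0; rewrite (axisymmetric_vec3 _ _ _ _ _ fF) expr0n addr0 sqrtr_sqr.
  by rewrite gtr0_norm.
by apply: derivable_upto_subset (derivable_upto_line m f ox _ k [::] Cf
  (coordinate_line_x 0 z) km).
Qed.

Lemma odd_dfact_gt0 k : (0 < odd_dfact k)%N.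
Proof. by apply: prodn_gt0 => i; rewrite addn1. Qed.

Lemma pderivs_halfplane_even m f F k cx cz r z : Ck m f -> axisymmetric f F ->
  (2 * k + cx + cz <= m)%N -> 0 < r ->
  pderivs (nseq cz oz ++ nseq cx ox ++ nseq (2 * k) oy) f (vec3 r 0 z) =
  (odd_dfact k)%:R * Dop k cx cz F r z.
Proof.
move=> Cf fF km r0.
have dk0 : (odd_dfact k)%:R != 0 :> R by rewrite pnatr_eq0 -lt0n odd_dfact_gt0.
(* Solving for the power of [d_r_over_r] makes it a multiple of a Cartesian derivative, whose
   regularity permits the further derivatives in [r] and [z]. *)
have fD : halfplane_multiple f (nseq (2 * k) oy) (odd_dfact k)%:R^-1
    (iter k (@d_r_over_r R) F).
  move=> s y s0; rewrite (pderivs_nseq_y m f F) //.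
    by rewrite mul2n odd_double doubleK mulKf.
  by apply: leq_trans km; rewrite -addnA leq_addr.
rewrite /Dop (halfplane_multiple_iter m f _ _ _ cx cz Cf _ fD)// ?size_nseq//.
by rewrite mulVKf.
Qed.

Lemma pderivs_halfplane_odd m f F k cx cz r z : Ck m f -> axisymmetric f F ->
  (k + cx + cz <= m)%N -> odd k -> 0 < r ->
  pderivs (nseq cz oz ++ nseq cx ox ++ nseq k oy) f (vec3 r 0 z) = 0.
Proof.
move=> Cf fF km kodd r0.
(* The odd [y]-derivative vanishes on the whole half-plane, so its derivatives in [x] and [z], taken
   within that half-plane, vanish too. *)
have f0 : halfplane_multiple f (nseq k oy) 1 (fun _ _ => 0).
  move=> s y s0; rewrite (pderivs_nseq_y m f F) // ?kodd ?mulr0//.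
  by apply: leq_trans km; rewrite -addnA leq_addr.
have d0 : iter cz (@d_z R) (iter cx (@d_r R) (fun _ _ => 0)) = (fun _ _ => 0).
  have -> : iter cx (@d_r R) (fun _ _ => 0) = (fun _ _ => 0).
    elim: cx {km} => //= cx ->; apply/funext => s; apply/funext => y.
    exact: derive1_cst.
  elim: cz {km} => //= cz ->; apply/funext => s; apply/funext => y.
  exact: derive1_cst.
have := halfplane_multiple_iter m f _ _ _ cx cz Cf _ f0 r z r0.
by rewrite d0 mul1r size_nseq => /(_ km).
Qed.

End CylindricalFrame.

(** * Tensor components and norms *)

Section TensorNorm.
Context {R : realType}.
Implicit Types (f : 'rV[R]_3 -> R) (F : R -> R -> R) (r t z : R).

(** In this order the [y]-derivatives are applied first and the [z]-derivatives last, as in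
    [Dop]. *)
Lemma perm_count3 (s : seq 'I_3) :
  perm_eq s (nseq (count_mem oz s) oz ++ nseq (count_mem ox s) ox ++
             nseq (count_mem oy s) oy).
Proof.
apply/allP => i _ /=; rewrite !count_cat !count_nseq /=.
have [->|[->|->]] : i = ox \/ i = oy \/ i = oz; last 3 first.
- by rewrite /= mul0n mul1n add0n addn0.
- by rewrite /= !mul0n mul1n !add0n.
- by rewrite /= !mul0n mul1n !addn0.
by case: i => -[|[|[|//]]] ?; [left|right; left|right; right]; exact: val_inj.
Qed.

Lemma size_count3 (s : seq 'I_3) :
  (count_mem oy s + count_mem ox s + count_mem oz s)%N = size s.
Proof.
rewrite [RHS](perm_size (perm_count3 s)) !size_cat !size_nseq.
by rewrite addnC (addnC (count_mem ox s)).
Qed.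

Lemma nabla_halfplane m f F (J : m.-tuple 'I_3) r z :
    Ck m f -> axisymmetric f F -> 0 < r ->
  nabla f (vec3 r 0 z) J =
  if odd (count_mem oy J) then 0 else
    (odd_dfact (count_mem oy J)./2)%:R *
      Dop (count_mem oy J)./2 (count_mem ox J) (count_mem oz J) F r z.
Proof.
move=> Cf fF r0; have pJ := perm_count3 J.
have sJ : (count_mem oy J + count_mem ox J + count_mem oz J = m)%N.
  by rewrite size_count3 size_tuple.
rewrite /nabla (pderivs_perm m f J _ Cf _ pJ) ?size_tuple//.
case: ifPn => [yodd|yeven].
  by apply: (pderivs_halfplane_odd m f F) => //; rewrite sJ.
have y2 : count_mem oy J = (2 * (count_mem oy J)./2)%N.
  by rewrite mul2n -[LHS]odd_double_half (negbTE yeven).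
rewrite [in nseq (count_mem oy J)]y2.
by apply: (pderivs_halfplane_even m f F) => //; rewrite -y2 sJ.
Qed.

Lemma eval_tensor_scale m (T : tensor R m) (c : 'I_m -> R) (a : 'I_m -> 'rV[R]_3) :
  eval_tensor T (fun k => c k *: a k) = (\prod_k c k) * eval_tensor T a.
Proof.
rewrite /eval_tensor mulr_sumr; apply: eq_bigr => J _.
rewrite mulrCA; congr (_ * _); rewrite -big_split; apply: eq_bigr => k _.
by rewrite mxE.
Qed.

Lemma slots_scale m mc mr mz (q : R) (a b c : 'rV[R]_3) (k : 'I_m) :
  slots mc mr mz (q *: a) b c k =
  (nseq (2 * mc) q ++ nseq (mr + mz) 1)`_k *: slots mc mr mz a b c k.
Proof.
rewrite /slots !nth_cat !size_nseq; case: ifPn => kmc; first by rewrite !nth_nseq kmc.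
rewrite !nth_nseq; case: (ltnP _ mr) => kmr; first by rewrite ltn_addr// scale1r.
have -> : (k - 2 * mc - mr < mz)%N = (k - 2 * mc < mr + mz)%N by lia.
(* Past the end of the lists both sides are the zero vector, by the default value of [nth]. *)
by case: ifP => _; rewrite ?scaler0 ?scale1r.
Qed.

Lemma prod_nseq_cat m mc mr mz (q : R) : (2 * mc + mr + mz)%N = m ->
  \prod_(k < m) (nseq (2 * mc) q ++ nseq (mr + mz) 1)`_k = q ^+ (2 * mc).
Proof.
move=> mE; transitivity (\prod_(x <- nseq (2 * mc) q ++ nseq (mr + mz) (1 : R)) x).
  by rewrite (big_nth 0) size_cat !size_nseq addnA mE big_mkord.
by rewrite big_cat !big_nseq !iter_mulr /= !mulr1 expr1n mulr1.
Qed.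

Lemma slots_frame m mc mr mz t (sm : size (nseq (2 * mc) oy ++ nseq mr ox ++
    nseq mz oz) == m) (k : 'I_m) :
  slots mc mr mz (e_theta t) (e_r t) (e_z R) k = frame t (tnth (Tuple sm) k).
Proof.
rewrite /slots (tnth_nth ox) -(nth_map ox 0); last by rewrite (eqP sm).
by rewrite !map_cat !map_nseq.
Qed.

(** The slots spell a word in the frame vectors; after [eval_frame] only the number of occurrences
    of each letter matters. *)
Lemma eval_tensor_slots m f F mc mr mz r t z :
    Ck m f -> axisymmetric f F -> (2 * mc + mr + mz)%N = m -> 0 < r ->
  eval_tensor (nabla f (cyl r t z))
    (slots (m := m) mc mr mz (e_theta t) (e_r t) (e_z R)) =
  (odd_dfact mc)%:R * Dop mc mr mz F r z.
Proof.
move=> Cf fF mE r0.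
have sm : size (nseq (2 * mc) oy ++ nseq mr ox ++ nseq mz oz) == m.
  by rewrite !size_cat !size_nseq addnA mE.
rewrite (_ : slots _ _ _ _ _ _ = fun k => frame t (tnth (Tuple sm) k)); last first.
  by apply/funext => k; exact: slots_frame.
rewrite (eval_frame m f F)// (nabla_halfplane m f F)//=.
rewrite !count_cat !count_nseq /= !mul0n !mul1n !addn0 !add0n.
by rewrite mul2n odd_double doubleK.
Qed.

(** * Comparison of the tensor norm with the sum of squares of the [Dop] terms *)

Lemma tensor_norm_sqr m (T : tensor R m) :
  tensor_norm T ^+ 2 = \sum_(J : m.-tuple 'I_3) T J ^+ 2.
Proof. by rewrite sqr_sqrtr// sumr_ge0// => J _; exact: sqr_ge0. Qed.

Lemma le_bigsum_term {I : finType} (P : pred I) (G : I -> R) i :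
  (forall j, 0 <= G j) -> P i -> G i <= \sum_(j | P j) G j.
Proof.
by move=> G0 Pi; rewrite (bigD1 i)//= lerDl sumr_ge0.
Qed.

Lemma tensor_component_le m (T : tensor R m) J : `|T J| <= tensor_norm T.
Proof.
rewrite -[leRHS]ger0_norm ?sqrtr_ge0// -ler_sqr ?nnegrE//.
rewrite !real_normK ?num_real// tensor_norm_sqr.
by apply: (le_bigsum_term predT (fun J => T J ^+ 2)) => // K; exact: sqr_ge0.
Qed.

Let N m : R := #|{: m.-tuple 'I_3}|%:R.

(** By rotation invariance each component at [x] is a sum of [N m] components at the rotated point,
    with coefficients at most [1] in absolute value. Squaring [N m * S] and summing over [N m]
    components gives the cube. *)
Lemma tensor_norm_frame_mx m f F x t : Ck m f -> axisymmetric f F ->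
  tensor_norm (nabla (m := m) f x) ^+ 2 <=
  N m ^+ 3 * tensor_norm (nabla (m := m) f (x *m frame_mx t)) ^+ 2.
Proof.
move=> Cf fF; set S := tensor_norm (nabla f (x *m _)).
have S0 : 0 <= S by exact: sqrtr_ge0.
have N0 : 0 <= N m by exact: ler0n.
rewrite tensor_norm_sqr (le_trans (ler_sum _ (_ : forall J, _ -> _ <= (N m * S) ^+ 2)))//.
  move=> J _; rewrite -[leRHS]real_normK ?num_real// -real_normK ?num_real//.
  rewrite ler_sqr ?nnegrE// [leRHS]ger0_norm ?mulr_ge0//.
  rewrite /nabla -{1}(axisymmetric_frame_mx f F t fF).
  rewrite (pderivs_mulmx m f _ m J _ Cf)//.
  rewrite (le_trans (ler_norm_sum _ _ _))//.
  rewrite (le_trans (ler_sum _ (_ : forall K, _ -> _ <= S)))//.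
    move=> K _; rewrite normrM -[leRHS]mul1r ler_pM//.
      by rewrite normr_prod prodr_ile1// => k _; rewrite normr_ge0 frame_mx_le1.
    exact: (tensor_component_le m (nabla f (x *m frame_mx t))).
  by rewrite sumr_const /N mulr_natl.
by rewrite sumr_const -/(N m) -mulr_natl -/(N m) exprMn mulrA -exprS.
Qed.

Let Dop_sum m F r z : R := \sum_(mc < m.+1) \sum_(mr < m.+1)
  \sum_(mz < m.+1 | (2 * mc + mr + mz == m)%N) `|Dop mc mr mz F r z| ^+ 2.

(** Each [Dop] term is dominated by a single tensor component, since an odd double factorial is at
    least [1]; the cube bounds the number of index triples. *)
Lemma Dop_sum_le_tensor_norm m f F r z : Ck m f -> axisymmetric f F -> 0 < r ->
  Dop_sum m F r z <= m.+1%:R ^+ 3 * tensor_norm (nabla (m := m) f (vec3 r 0 z)) ^+ 2.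
Proof.
move=> Cf fF r0; set S := _ ^+ 2.
have S0 : 0 <= S by exact: sqr_ge0.
have term (mc mr mz : 'I_m.+1) : (2 * mc + mr + mz == m)%N ->
    `|Dop mc mr mz F r z| ^+ 2 <= S.
  move=> /eqP mE.
  have sm : size (nseq (2 * mc) oy ++ nseq mr ox ++ nseq mz oz) == m.
    by rewrite !size_cat !size_nseq addnA mE.
  have := tensor_component_le m (nabla f (vec3 r 0 z)) (Tuple sm).
  rewrite (nabla_halfplane m f F)//=.
  rewrite !count_cat !count_nseq /= !mul0n !mul1n !addn0 !add0n.
  rewrite mul2n odd_double doubleK normrM => le_norm.
  rewrite ler_sqr ?nnegrE ?sqrtr_ge0//; apply: le_trans le_norm.
  by rewrite ler_peMl// normr_nat ler1n odd_dfact_gt0.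
have sumS (G : 'I_m.+1 -> R) (b : R) : (forall i, G i <= b) -> \sum_i G i <= m.+1%:R * b.
  move=> Gb; rewrite (le_trans (ler_sum _ (fun i _ => Gb i)))//.
  by rewrite sumr_const card_ord mulr_natl.
rewrite exprS expr2 -!mulrA; apply: (@sumS) => mc; apply: (@sumS) => mr.
rewrite big_mkcond; apply: (@sumS) => mz; case: ifP => //; exact: term.
Qed.

Lemma tensor_norm_le_Dop_sum m f F r z : Ck m f -> axisymmetric f F -> 0 < r ->
  tensor_norm (nabla (m := m) f (vec3 r 0 z)) ^+ 2 <=
  N m * (\max_(k < m.+1) odd_dfact k)%:R ^+ 2 * Dop_sum m F r z.
Proof.
move=> Cf fF r0; set M := (\max_(k < _) _)%:R.
have B0 : 0 <= Dop_sum m F r z.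
  by do 3!apply: sumr_ge0 => ? _; exact: sqr_ge0.
rewrite tensor_norm_sqr.
rewrite (le_trans (ler_sum _ (_ : forall J, _ -> _ <= M ^+ 2 * Dop_sum m F r z)))//.
  move=> J _; rewrite (nabla_halfplane m f F)//; case: ifPn => [_|yeven].
    by rewrite expr0n mulr_ge0// sqr_ge0.
  have sJ : (count_mem oy J + count_mem ox J + count_mem oz J = m)%N.
    by rewrite size_count3 size_tuple.
  have y2 : (2 * (count_mem oy J)./2)%N = count_mem oy J.
    by rewrite mul2n -[RHS]odd_double_half (negbTE yeven).
  have [ym xm zm] : [/\ (count_mem oy J)./2 < m.+1, count_mem ox J < m.+1 &
      count_mem oz J < m.+1]%N.
    by move: sJ; rewrite -y2; split; lia.
  rewrite exprMn ler_pM ?sqr_ge0//.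
    by rewrite ler_sqr ?nnegrE// ler_nat (leq_bigmax (Ordinal ym)).
  rewrite -real_normK ?num_real//.
  (* The one term matching the letter counts of [J] is extracted from the triple sum, one level at a
     time. *)
  apply: le_trans (le_bigsum_term predT _ (Ordinal ym) _ isT) => [|k]; last first.
    by do 2!apply: sumr_ge0 => ? _; exact: sqr_ge0.
  apply: le_trans (le_bigsum_term predT _ (Ordinal xm) _ isT) => [|k]; last first.
    by apply: sumr_ge0 => ? _; exact: sqr_ge0.
  apply: (le_bigsum_term _ (fun i : 'I_m.+1 => `|Dop _ _ i F r z| ^+ 2) (Ordinal zm)).
    by move=> k; exact: sqr_ge0.
  by rewrite /= y2 sJ.
by rewrite sumr_const -mulr_natl mulrA.
Qed.

End TensorNorm.

Theorem proposition2p2 (R : realType) (m : nat) :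
  (forall (f : 'rV[R]_3 -> R) (F : R -> R -> R) (mc mr mz : nat),
     Ck m f -> axisymmetric f F -> (2 * mc + mr + mz)%N = m ->
     forall r t z : R, 0 < r ->
       eval_tensor (nabla f (cyl r t z))
         (slots (m := m) mc mr mz (E_theta r t) (E_r t) (E_z R))
         = (odd_dfact mc)%:R * r ^+ (2 * mc) * Dop mc mr mz F r z
       /\
       eval_tensor (nabla f (cyl r t z))
         (slots (m := m) mc mr mz (e_theta t) (e_r t) (e_z R))
         = (odd_dfact mc)%:R * Dop mc mr mz F r z)
  /\
  (exists C : R, 0 < C /\
     forall (f : 'rV[R]_3 -> R) (F : R -> R -> R),
       Ck m f -> axisymmetric f F ->
       forall r t z : R, 0 < r ->
         let A := tensor_norm (nabla (m := m) f (cyl r t z)) ^+ 2 in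
         let B := \sum_(mc < m.+1) \sum_(mr < m.+1)
                    \sum_(mz < m.+1 | (2 * mc + mr + mz == m)%N)
                      `|Dop mc mr mz F r z| ^+ 2 in
         A <= C * B /\ B <= C * A).
Proof.
split=> [f F mc mr mz Cf fF mE r t z r0|].
  (* The orthonormal formula comes first; multilinearity then gives the covariant one, each of the
     [2 * mc] angular slots contributing a factor [r]. *)
  have unscaled := eval_tensor_slots m f F mc mr mz r t z Cf fF mE r0.
  split=> //; rewrite (_ : slots _ _ _ _ _ _ = fun k =>
      (nseq (2 * mc) r ++ nseq (mr + mz) 1)`_k *:
        slots mc mr mz (e_theta t) (e_r t) (e_z R) k); last first.
    by apply/funext => k; exact: slots_scale.
  by rewrite eval_tensor_scale prod_nseq_cat// unscaled mulrCA mulrA.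
pose N : R := #|{: m.-tuple 'I_3}|%:R.
pose M : R := (\max_(k < m.+1) odd_dfact k)%:R.
have N0 : 0 < N by rewrite ltr0n card_tuple card_ord expn_gt0.
have X0 : 0 <= N * M ^+ 2 by rewrite mulr_ge0 ?sqr_ge0// ltW.
have Y0 : 0 < m.+1%:R ^+ 3 :> R by rewrite exprn_gt0// ltr0n.
(* The factor [N ^+ 3] pays for the rotation to the half-plane; the two summands are the constants
   of the two comparisons there, added so that one constant serves both directions. *)
exists (N ^+ 3 * (N * M ^+ 2 + m.+1%:R ^+ 3)); split.
  by rewrite mulr_gt0 ?exprn_gt0// ltr_wpDl.
move=> f F Cf fF r t z r0 A B.
have N30 : 0 <= N ^+ 3 by rewrite exprn_ge0// ltW.
have A0 : 0 <= A by exact: sqr_ge0.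
have B0 : 0 <= B by do 3!apply: sumr_ge0 => ? _; exact: sqr_ge0.
pose A' := tensor_norm (nabla (m := m) f (vec3 r 0 z)) ^+ 2.
have AA' : A <= N ^+ 3 * A'.
  (* The same rotation estimate is used with angle [- t] here and with angle [t] for the
     converse. *)
  have := tensor_norm_frame_mx m f F (cyl r t z) (- t) Cf fF.
  by rewrite cyl_frame_mx subrr cyl0.
have A'A : A' <= N ^+ 3 * A.
  have := tensor_norm_frame_mx m f F (vec3 r 0 z) t Cf fF.
  by rewrite /A' -cyl0 cyl_frame_mx add0r.
have A'B : A' <= N * M ^+ 2 * B by exact: tensor_norm_le_Dop_sum Cf fF r0.
have BA' : B <= m.+1%:R ^+ 3 * A' by exact: Dop_sum_le_tensor_norm Cf fF r0.
split.
  apply: le_trans AA' _; rewrite -mulrA ler_wpM2l// (le_trans A'B)//.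
  by rewrite ler_wpM2r// lerDl ltW.
apply: le_trans BA' _; apply: (@le_trans _ _ (m.+1%:R ^+ 3 * (N ^+ 3 * A))).
  by rewrite ler_wpM2l// ltW.
by rewrite mulrCA mulrA ler_wpM2r// ler_wpM2l// lerDr.
Qed.
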